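(* Consider a Markov jump positive semilinear problem satisfying the Markov jump versions of Closure and Attainability, Stabilizability, State Space Structure, Observability, and the Cartesian Product Condition, and its deterministic equivalent problem (all as defined in the context). Then: (a) There exists an $r$-tuple $c^*=(c^*(1),\dots,c^*(r))$, $c^*(i)\in\mathbb R^n_+$ for $i=1,\dots,r$, such that the optimal cost functions $J^*$ of the Markov jump problem and $\overline J^*$ of the deterministic equivalent problem satisfy $$J^*(x,\theta)=c^*(\theta)'x\quad\text{for all }x\in X,\ \theta\in\Theta,$$ $$\overline J^*(\bar x)=\sum_{\theta=1}^rc^*(\theta)'x^\theta\quad\text{for all }\bar x=(x^1,\dots,x^r)\in\overline X.$$ Moreover, $c^*$ is the unique nonnegative $r$-tuple that satisfies $c^*(\theta)=\big(\overline G(c^* )\big)(\theta)$ for all $\theta\in\Theta$, or equivalently $c^*=\overline G(c^* )$. (b) A policy $\mu\in\widehat{\mathcal M}$ is optimal for the Markov jump problem if and only if the corresponding policy $\bar\mu\in\overline{\mathcal M}$, given by $\bar\mu(\bar x)=(\mu(x^1,1),\dots,\mu(x^r,r))$, is optimal for the deterministic equivalent problem. Moreover, there exists at least one optimal policy for the Markov jump problem.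
   Context: Notation: $\mathbb R^n_+$ is the set of vectors in $\mathbb R^n$ with nonnegative components; a prime denotes transposition. A square matrix is stable if all its eigenvalues lie strictly within the unit circle. Markov jump positive semilinear problem: $X\subset\mathbb R^n_+$; the parameter $\theta$ takes values in $\Theta=\{1,\dots,r\}$ and evolves as a Markov chain with transition probabilities $p_{ij}=P(\theta_{k+1}=j\mid\theta_k=i)$. The augmented state is $(x_k,\theta_k)\in X\times\Theta$, known when the control is chosen. $U(x,\theta)$ are nonempty control constraint sets; $\alpha\in(0,1]$. For each $(x_0,\theta_0)$ the problem is to minimize $\lim_{N\to\infty}E\{\sum_{k=0}^{N-1}\alpha^kg(x_k,\theta_k,\mu_k(x_k,\theta_k),w_k)\}$ over sequences $\{\mu_k\}$ with $\mu_k(x,\theta)\in U(x,\theta)$, subject to $x_{k+1}=f(x_k,\theta_k,\mu_k(x_k,\theta_k),w_k)$, $\theta_{k+1}=w_k$, where $w_k\in\Theta$ has distribution $P(w_k=j\mid\theta_k=i)=p_{ij}$. $J^*(x_0,\theta_0)$ is the optimal cost (infimum). $E_w\{\cdot\mid\theta\}$ denotes expectation over $w$ with $P(w=j)=p_{\theta j}$. For all $x\in X$, $\theta,w\in\Theta$, $u\in U(x,\theta)$: $f(x,\theta,u,w)\in X$, $E_w\{f(x,\theta,u,w)\mid\theta\}\in X$, $g(x,\theta,u,w)\ge0$. A (stationary) policy is a function $\mu$ on $X\times\Theta$ with $\mu(x,\theta)\in U(x,\theta)$; a policy (for either problem) is optimal if using it at every stage attains the optimal cost from every initial state. $\widehat{\mathcal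 M}$ is a given set of policies such that for every $\mu\in\widehat{\mathcal M}$, $\theta,w\in\Theta$ there exist an $n\times n$ nonnegative matrix $A_\mu^{\theta w}$ and a nonnegative vector $q_\mu^{\theta w}\in\mathbb R^n$ with $f(x,\theta,\mu(x,\theta),w)=A_\mu^{\theta w}x$ and $g(x,\theta,\mu(x,\theta),w)=(q_\mu^{\theta w})'x$ for all $x\in X$. $\mathcal C$ is the set of $r$-tuples $c=(c(1),\dots,c(r))$ with $c(\theta)\in\mathbb R^n_+$ (identified with $\mathbb R^{rn}_+$), and $\widehat{\mathcal J}$ is the set of functions $J(x,\theta)=c(\theta)'x$ with $c\in\mathcal C$. For $\mu\in\widehat{\mathcal M}$, $\bar A_\mu$ is the $rn\times rn$ matrix whose $(i,j)$ block of size $n\times n$ is $p_{ji}A_\mu^{ji}$, $i,j=1,\dots,r$. Assumptions (Markov jump versions): Closure and Attainability: for every $c\in\mathcal C$, the function $(x,\theta)\mapsto\min_{u\in U(x,\theta)}E_w\{g(x,\theta,u,w)+\alpha c(w)'f(x,\theta,u,w)\mid\theta\}$ belongs to $\widehat{\mathcal J}$, i.e., equals $\hat c(\theta)'x$ for some unique $\hat c\in\mathcal C$; $\hat c$ depends continuously on $c$; and for every $\theta\in\Theta$ there is a policy $\mu\in\widehat{\mathcal M}$ such that $\mu(x,\theta)$ attains this minimum for all $x\in X$. Stabilizability: there exists $\hat\mu\in\widehat{\mathcal M}$ such that $\alpha\bar A_{\hat\mu}$ is stable. State Space Structure: for some scalar $s>0$, every $x\in\mathbb R^n_+$ with $\sum_{i=1}^nx^i\le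 s$ belongs to $X$ (here $x^i$ is the $i$th component of $x$). Observability: there exists an integer $N$ such that the optimal cost of the $N$-stage problem of minimizing $E\{\sum_{k=0}^{N-1}\alpha^kg(x_k,\theta_k,u_k,w_k)\}$, starting from any nonzero $x_0\in X$ and any $\theta_0\in\Theta$, is strictly positive. Cartesian Product Condition: for every $\mu^1,\dots,\mu^r\in\widehat{\mathcal M}$, the policy that applies $\mu^\theta(x,\theta)$ at each $(x,\theta)$ belongs to $\widehat{\mathcal M}$. The mapping $\overline G:\mathcal C\to\mathcal C$ is defined by letting $\overline G(c)$ be the unique element of $\mathcal C$ with $\big(\overline G(c)\big)(\theta)'x=\min_{u\in U(x,\theta)}E_w\{g(x,\theta,u,w)+\alpha c(w)'f(x,\theta,u,w)\mid\theta\}$ for all $x\in X$, $\theta\in\Theta$. Deterministic equivalent problem: the state space is $\overline X=\{\bar x=(x^1,\dots,x^r): x^i\in X\}$; $\overline U(\bar x)=\prod_{\theta=1}^rU(x^\theta,\theta)$, with elements $\bar u=(u^1,\dots,u^r)$; the system is $\bar x_{k+1}=\bar f(\bar x_k,\bar u_k)$ with $\bar f=(\bar f^1,\dots,\bar f^r)$, $\bar f^\theta(\bar x,\bar u)=\sum_{i=1}^rp_{i\theta}f(x^i,i,u^i,\theta)$ (it is understood that $\bar f(\bar x,\bar u)\in\overline X$ for all $\bar x\in\overline X$, $\bar u\in\overline U(\bar x)$); the cost per stage is $\bar g(\bar x,\bar u)=\sum_{\theta=1}^rE_w\{g(x^\theta,\theta,u^\theta,w)\mid\theta\}$. The problem is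 to minimize $\sum_{k=0}^\infty\alpha^k\bar g(\bar x_k,\bar u_k)$ over $\{\bar u_k\}$ with $\bar u_k\in\overline U(\bar x_k)$; $\overline J^*(\bar x_0)$ is the optimal cost (infimum) starting from $\bar x_0\in\overline X$. $\overline{\mathcal M}$ is the set of policies $\bar\mu(\bar x)=(\mu(x^1,1),\dots,\mu(x^r,r))$ with $\mu\in\widehat{\mathcal M}$. *)

(* Defs.v *)
From HB Require Import structures.
From mathcomp Require Export all_boot all_order all_algebra.
From mathcomp Require Export all_classical all_reals all_analysis.
From mathcomp Require Export complex.

Set Implicit Arguments.
Unset Strict Implicit.
Unset Printing Implicit Defensive.

Import Order.TTheory GRing.Theory Num.Theory.
Import numFieldNormedType.Exports.

Local Open Scope classical_set_scope.
Local Open Scope ring_scope.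

Definition nonneg_mx (R : realType) (m n : nat) (M : 'M[R]_(m, n)) : Prop :=
  forall i j, 0 <= M i j.

Definition dotv (R : realType) (n : nat) (a b : 'cV[R]_n) : R :=
  (a^T *m b) 0 0.

(* The eigenvalues are the complex ones, so M is first mapped to R[i]. *)
Definition stable (R : realType) (m : nat) (M : 'M[R]_m) : Prop :=
  forall z : R[i], eigenvalue (map_mx (real_complex R) M) z -> `|z| < 1.

(* Control constraints, dynamics, costs and policies are total functions of the
   continuous state; their values outside mj_X are irrelevant.  The parameter
   set is 'I_r, numbered from 0.  mj_A and mj_q are only meaningful for the
   policies in mj_Mhat. *)
Record mjproblem (R : realType) (n r : nat) (C : Type) := MJProblem {
  mj_X : set 'cV[R]_n;
  mj_p : 'I_r -> 'I_r -> R;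
  mj_U : 'cV[R]_n -> 'I_r -> set C;
  mj_f : 'cV[R]_n -> 'I_r -> C -> 'I_r -> 'cV[R]_n;
  mj_g : 'cV[R]_n -> 'I_r -> C -> 'I_r -> R;
  mj_alpha : R;
  mj_Mhat : set ('cV[R]_n -> 'I_r -> C);
  mj_A : ('cV[R]_n -> 'I_r -> C) -> 'I_r -> 'I_r -> 'M[R]_n;
  mj_q : ('cV[R]_n -> 'I_r -> C) -> 'I_r -> 'I_r -> 'cV[R]_n
}.

Definition is_policy (R : realType) (n r : nat) (C : Type)
    (P : mjproblem R n r C) (mu : 'cV[R]_n -> 'I_r -> C) : Prop :=
  forall x th, mj_X P x -> mj_U P x th (mu x th).

Record mj_semilinear (R : realType) (n r : nat) (C : Type)
    (P : mjproblem R n r C) : Prop := Semilinear {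
  sl_p_ge0 : forall i j, 0 <= mj_p P i j;
  sl_p_sum1 : forall i, \sum_(j < r) mj_p P i j = 1;
  sl_alpha : 0 < mj_alpha P <= 1;
  sl_X_ge0 : forall x, mj_X P x -> nonneg_mx x;
  sl_U_nonempty : forall x th, mj_X P x -> mj_U P x th !=set0;
  sl_f_X : forall x th u w, mj_X P x -> mj_U P x th u ->
    mj_X P (mj_f P x th u w);
  sl_Ef_X : forall x th u, mj_X P x -> mj_U P x th u ->
    mj_X P (\sum_(w < r) mj_p P th w *: mj_f P x th u w);
  sl_g_ge0 : forall x th u w, mj_X P x -> mj_U P x th u ->
    0 <= mj_g P x th u w;
  sl_Mhat_policy : forall mu, mj_Mhat P mu -> is_policy P mu;
  sl_A_ge0 : forall mu th w, mj_Mhat P mu -> nonneg_mx (mj_A P mu th w);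
  sl_q_ge0 : forall mu th w, mj_Mhat P mu -> nonneg_mx (mj_q P mu th w);
  sl_f_linear : forall mu th w x, mj_Mhat P mu -> mj_X P x ->
    mj_f P x th (mu x th) w = mj_A P mu th w *m x;
  sl_g_linear : forall mu th w x, mj_Mhat P mu -> mj_X P x ->
    mj_g P x th (mu x th) w = dotv (mj_q P mu th w) x
}.

(* For a realization w of the disturbances, th_0 = th0 and th_(k+1) = w_k. *)
Definition mode (r : nat) (th0 : 'I_r) (w : nat -> 'I_r) (k : nat) : 'I_r :=
  if k is k'.+1 then w k' else th0.

Fixpoint mj_state (R : realType) (n r : nat) (C : Type)
    (P : mjproblem R n r C) (pi : nat -> 'cV[R]_n -> 'I_r -> C)
    (x0 : 'cV[R]_n) (th0 : 'I_r) (w : nat -> 'I_r) (k : nat) : 'cV[R]_n :=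
  if k is k'.+1 then
    let x := mj_state P pi x0 th0 w k' in
    let th := mode th0 w k' in
    mj_f P x th (pi k' x th) (w k')
  else x0.

Definition path_cost (R : realType) (n r : nat) (C : Type)
    (P : mjproblem R n r C) (pi : nat -> 'cV[R]_n -> 'I_r -> C)
    (x0 : 'cV[R]_n) (th0 : 'I_r) (w : nat -> 'I_r) (N : nat) : R :=
  \sum_(k < N)
     let x := mj_state P pi x0 th0 w k in
     let th := mode th0 w k in
     mj_alpha P ^+ k * mj_g P x th (pi k x th) (w k).

Definition path_prob (R : realType) (n r : nat) (C : Type)
    (P : mjproblem R n r C) (th0 : 'I_r) (w : nat -> 'I_r) (N : nat) : R :=
  \prod_(k < N) mj_p P (mode th0 w k) (w k).

(* The N-stage cost depends on w_0, ..., w_(N-1) only, so its expectation is the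
   finite sum over their joint values (the default th0 of nth is never read). *)
Definition expected_cost (R : realType) (n r : nat) (C : Type)
    (P : mjproblem R n r C) (pi : nat -> 'cV[R]_n -> 'I_r -> C)
    (x0 : 'cV[R]_n) (th0 : 'I_r) (N : nat) : R :=
  \sum_(w : N.-tuple 'I_r)
     path_prob P th0 (nth th0 w) N * path_cost P pi x0 th0 (nth th0 w) N.

Definition admissible (R : realType) (n r : nat) (C : Type)
    (P : mjproblem R n r C) : set (nat -> 'cV[R]_n -> 'I_r -> C) :=
  [set pi | forall k, is_policy P (pi k)].

Definition mj_cost (R : realType) (n r : nat) (C : Type)
    (P : mjproblem R n r C) (pi : nat -> 'cV[R]_n -> 'I_r -> C)
    (x0 : 'cV[R]_n) (th0 : 'I_r) : \bar R :=
  limn (fun N => (expected_cost P pi x0 th0 N)%:E).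

Definition Jstar (R : realType) (n r : nat) (C : Type)
    (P : mjproblem R n r C) (x0 : 'cV[R]_n) (th0 : 'I_r) : \bar R :=
  ereal_inf [set mj_cost P pi x0 th0 | pi in admissible P].

Definition Jstar_stage (R : realType) (n r : nat) (C : Type)
    (P : mjproblem R n r C) (N : nat) (x0 : 'cV[R]_n) (th0 : 'I_r) : \bar R :=
  ereal_inf [set (expected_cost P pi x0 th0 N)%:E | pi in admissible P].

Definition mj_optimal (R : realType) (n r : nat) (C : Type)
    (P : mjproblem R n r C) (mu : 'cV[R]_n -> 'I_r -> C) : Prop :=
  forall x th, mj_X P x -> mj_cost P (fun=> mu) x th = Jstar P x th.

(* An r-tuple c is the n x r matrix whose column th is c(th). *)
Definition Cset (R : realType) (n r : nat) : set 'M[R]_(n, r) :=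
  [set c | nonneg_mx c].

Definition Qfactor (R : realType) (n r : nat) (C : Type)
    (P : mjproblem R n r C) (c : 'M[R]_(n, r))
    (x : 'cV[R]_n) (th : 'I_r) (u : C) : R :=
  \sum_(w < r) mj_p P th w *
    (mj_g P x th u w + mj_alpha P * dotv (col w c) (mj_f P x th u w)).

Definition is_minimum (R : realType) (S : set R) (v : R) : Prop :=
  S v /\ lbound S v.

Definition bellman_image (R : realType) (n r : nat) (C : Type)
    (P : mjproblem R n r C) (c d : 'M[R]_(n, r)) : Prop :=
  Cset d /\
  forall x th, mj_X P x ->
    is_minimum [set Qfactor P c x th u | u in mj_U P x th]
               (dotv (col th d) x).

(* Definite description: closure_attainability makes it well defined on Cset;
   the value 0 is only used where no image exists. *)
Definition Gbar (R : realType) (n r : nat) (C : Type)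
    (P : mjproblem R n r C) (c : 'M[R]_(n, r)) : 'M[R]_(n, r) :=
  xget 0 [set d | bellman_image P c d].

Definition closure_attainability (R : realType) (n r : nat) (C : Type)
    (P : mjproblem R n r C) : Prop :=
  [/\ forall c, Cset c -> exists! d, bellman_image P c d,
      {within @Cset R n r, continuous (Gbar P)}
    & forall c, Cset c -> forall th, exists2 mu, mj_Mhat P mu &
        forall x, mj_X P x ->
          is_minimum [set Qfactor P c x th u | u in mj_U P x th]
                     (Qfactor P c x th (mu x th))].

Definition Abar (R : realType) (n r : nat) (C : Type)
    (P : mjproblem R n r C) (mu : 'cV[R]_n -> 'I_r -> C) :
    'M[R]_(\sum_(i < r) n) :=
  \mxblock_(i < r, j < r) (mj_p P j i *: mj_A P mu j i).

Definition stabilizability (R : realType) (n r : nat) (C : Type)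
    (P : mjproblem R n r C) : Prop :=
  exists2 mu, mj_Mhat P mu & stable (mj_alpha P *: Abar P mu).

Definition state_space_structure (R : realType) (n r : nat) (C : Type)
    (P : mjproblem R n r C) : Prop :=
  exists2 s : R, 0 < s &
    forall x, nonneg_mx x -> \sum_(i < n) x i 0 <= s -> mj_X P x.

Definition observability (R : realType) (n r : nat) (C : Type)
    (P : mjproblem R n r C) : Prop :=
  exists N : nat, forall x th, mj_X P x -> x != 0 ->
    (0 < Jstar_stage P N x th)%E.

Definition cartesian_product (R : realType) (n r : nat) (C : Type)
    (P : mjproblem R n r C) : Prop :=
  forall m : 'I_r -> 'cV[R]_n -> 'I_r -> C,
    (forall th, mj_Mhat P (m th)) -> mj_Mhat P (fun x th => m th x th).

Definition Xbar (R : realType) (n r : nat) (C : Type)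
    (P : mjproblem R n r C) : set ('I_r -> 'cV[R]_n) :=
  [set xb | forall th, mj_X P (xb th)].

Definition Ubar (R : realType) (n r : nat) (C : Type)
    (P : mjproblem R n r C) (xb : 'I_r -> 'cV[R]_n) : set ('I_r -> C) :=
  [set ub | forall th, mj_U P (xb th) th (ub th)].

Definition fbar (R : realType) (n r : nat) (C : Type)
    (P : mjproblem R n r C) (xb : 'I_r -> 'cV[R]_n) (ub : 'I_r -> C) :
    'I_r -> 'cV[R]_n :=
  fun th => \sum_(i < r) mj_p P i th *: mj_f P (xb i) i (ub i) th.

Definition gbar (R : realType) (n r : nat) (C : Type)
    (P : mjproblem R n r C) (xb : 'I_r -> 'cV[R]_n) (ub : 'I_r -> C) : R :=
  \sum_(th < r) \sum_(w < r) mj_p P th w * mj_g P (xb th) th (ub th) w.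

Definition deterministic_wf (R : realType) (n r : nat) (C : Type)
    (P : mjproblem R n r C) : Prop :=
  forall xb ub, Xbar P xb -> Ubar P xb ub -> Xbar P (fbar P xb ub).

Fixpoint det_state (R : realType) (n r : nat) (C : Type)
    (P : mjproblem R n r C) (u : nat -> 'I_r -> C) (xb0 : 'I_r -> 'cV[R]_n)
    (k : nat) : 'I_r -> 'cV[R]_n :=
  if k is k'.+1 then fbar P (det_state P u xb0 k') (u k') else xb0.

Definition det_admissible (R : realType) (n r : nat) (C : Type)
    (P : mjproblem R n r C) (xb0 : 'I_r -> 'cV[R]_n) :
    set (nat -> 'I_r -> C) :=
  [set u | forall k, Ubar P (det_state P u xb0 k) (u k)].

Definition det_cost (R : realType) (n r : nat) (C : Type)
    (P : mjproblem R n r C) (u : nat -> 'I_r -> C)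
    (xb0 : 'I_r -> 'cV[R]_n) : \bar R :=
  (\sum_(0 <= k <oo)
     (mj_alpha P ^+ k * gbar P (det_state P u xb0 k) (u k))%:E)%E.

Definition Jbarstar (R : realType) (n r : nat) (C : Type)
    (P : mjproblem R n r C) (xb0 : 'I_r -> 'cV[R]_n) : \bar R :=
  ereal_inf [set det_cost P u xb0 | u in det_admissible P xb0].

Definition det_policy_cost (R : realType) (n r : nat) (C : Type)
    (P : mjproblem R n r C) (nu : ('I_r -> 'cV[R]_n) -> 'I_r -> C)
    (xb0 : 'I_r -> 'cV[R]_n) : \bar R :=
  det_cost P (fun k => nu (iter k (fun xb => fbar P xb (nu xb)) xb0)) xb0.

Definition det_optimal (R : realType) (n r : nat) (C : Type)
    (P : mjproblem R n r C) (nu : ('I_r -> 'cV[R]_n) -> 'I_r -> C) : Prop :=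
  forall xb, Xbar P xb -> det_policy_cost P nu xb = Jbarstar P xb.

Definition lift_policy (R : realType) (n r : nat) (C : Type)
    (mu : 'cV[R]_n -> 'I_r -> C) : ('I_r -> 'cV[R]_n) -> 'I_r -> C :=
  fun xb th => mu (xb th) th.

(* Main.v *)
(* The value iterates c_N = Gbar^N 0 give the N-stage optimal costs.  They
   increase and are bounded by the costs of the stabilizing policy, so they
   converge, by continuity to a fixed point c of Gbar.  Every control sequence
   of either problem costs at least c_N over N stages, while a policy attaining
   Gbar c costs T^N 0 <= c, where T is its affine map and T c = c.
   A fixed point c' lies above every c_N, hence above c.  Observability makes c
   positive, so c' <= K c for some K, and then c' <= T^N c' forces c' <= c. *)

From mathcomp Require Import ring.
Require Import Defs.

Set Implicit Arguments.
Unset Strict Implicit.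
Unset Printing Implicit Defensive.

Import Order.TTheory GRing.Theory Num.Theory.
Import numFieldNormedType.Exports.

Local Open Scope classical_set_scope.
Local Open Scope ring_scope.

(** * Absolute summability of the powers of a stable matrix *)

Definition abs_summable (F : numFieldType) (v : nat -> F) :=
  exists B, forall N, \sum_(k < N) `|v k| <= B.

(** With S_N the partial sums, the triangle inequality gives S_N <= S_(N+1) <= |v_0| + B + |z| S_N,
    which |z| < 1 allows to solve for S_N. *)
Lemma summable_recursion (F : numFieldType) (z : F) (v : nat -> F) :
  `|z| < 1 -> abs_summable (fun k => v k.+1 - z * v k) -> abs_summable v.
Proof.
move=> z1 [B hB]; exists ((`|v 0%N| + B) / (1 - `|z|)) => N.
rewrite ler_pdivlMr ?subr_gt0// mulrBr mulr1 lerBlDr.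
have le_sum : \sum_(k < N) `|v k| <= \sum_(k < N.+1) `|v k|.
  by rewrite big_ord_recr /= lerDl.
apply: (le_trans le_sum); rewrite big_ord_recl /= -addrA lerD2l.
rewrite mulr_suml (le_trans _ (lerD (hB N) (lexx _)))// -big_split /=.
apply: ler_sum => k _; rewrite [_ * `|z|]mulrC -normrM.
by apply: le_trans (ler_normD _ _); rewrite subrK.
Qed.

(* The sequence q(A) A^k vanishes for q the characteristic polynomial, and
   (p (X - z))(A) A^k = p(A) A^(k+1) - z p(A) A^k lets the roots z of q be removed
   one at a time. *)
Lemma summable_mx_powers (F : numClosedFieldType) (m : nat) (A : 'M[F]_m.+1) :
  (forall z, eigenvalue A z -> `|z| < 1) ->
  forall i j, abs_summable (fun k => (A ^+ k) i j).
Proof.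
move=> eigA.
have factors (s : seq F) : all (fun z => `|z| < 1) s -> forall p : {poly F},
    (forall i j, abs_summable (fun k =>
       (horner_mx A (p * \prod_(z <- s) ('X - z%:P)) * A ^+ k) i j)) ->
    forall i j, abs_summable (fun k => (horner_mx A p * A ^+ k) i j).
  elim: s => [_ p|z s IHs /= /andP[z1 s1] p hp i j].
    by rewrite big_nil mulr1.
  apply: (summable_recursion (z := z)) => //.
  have [B hB] : abs_summable
      (fun k => (horner_mx A (p * ('X - z%:P)) * A ^+ k) i j).
    apply: IHs => // i' j'; have [B hB] := hp i' j'; exists B => N.
    by move: (hB N); rewrite big_cons !mulrA.
  exists B => N; move: (hB N); congr (_ <= _); apply: eq_bigr => k _.
  rewrite rmorphM rmorphB /= horner_mx_X horner_mx_C mulrBr mulrBl -mulrA.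
  rewrite -exprS -mulmxE mul_mx_scalar -scalemxAl.
  by rewrite !mxE.
have [s char_s] := closed_field_poly_normal (char_poly A).
rewrite (monicP (char_poly_monic A)) scale1r in char_s.
move=> i j; have [|i' j'|B hB] := factors s _ 1 _ i j.
- apply/allP => z zs; apply: eigA.
  by rewrite eigenvalue_root_char char_s root_prod_XsubC.
- exists 0 => N; rewrite mul1r -char_s Cayley_Hamilton big1// => k _.
  by rewrite mul0r mxE normr0.
- by exists B => N; move: (hB N); under eq_bigr do rewrite rmorph1 mul1r.
Qed.

(** Size 0 has no entries. Otherwise the embedding into [R[i]] commutes with powers and preserves
    absolute values, so the complex bound passes to its real part. *)
Lemma stable_summable (R : realType) (m : nat) (M : 'M[R]_m) :
  stable M -> forall i j, abs_summable (fun k => (M ^+ k) i j).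
Proof.
case: m M => [|m] M stM i j; first by case: i.
have [B hB] := summable_mx_powers stM i j.
exists (complex.Re B) => N.
have -> : \sum_(k < N) `|(M ^+ k) i j| =
    complex.Re (\sum_(k < N) `|(map_mx (real_complex R) M ^+ k) i j|).
  rewrite raddf_sum; apply: eq_bigr => k _.
  by rewrite -rmorphXn mxE normc_def /= expr0n addr0 sqrtr_sqr.
by have := hB N; rewrite lecE => /andP[].
Qed.

(** * Expected costs and conditioning on the first disturbance *)

Lemma big_tuple_cons (V : nmodType) (I : finType) (N : nat)
    (F : N.+1.-tuple I -> V) :
  \sum_(t : N.+1.-tuple I) F t =
  \sum_(i : I) \sum_(t : N.-tuple I) F (cons_tuple i t).
Proof.
rewrite pair_bigA /=
  (reindex (fun it : I * N.-tuple I => cons_tuple it.1 it.2)) //.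
exists (fun t => (thead t, behead_tuple t)) => [[i t] _|t _] /=.
  by rewrite theadE; congr (_, _); apply: val_inj.
by apply: val_inj; rewrite [in RHS](tuple_eta t).
Qed.

Section ExpectedCost.
Variables (R : realType) (n r : nat) (C : Type) (P : mjproblem R n r C).
Implicit Types (pi : nat -> 'cV[R]_n -> 'I_r -> C) (w : nat -> 'I_r).

Lemma eq_mode (th : 'I_r) w w' N : (forall k, (k < N)%N -> w k = w' k) ->
  forall k, (k <= N)%N -> mode th w k = mode th w' k.
Proof. by move=> eq_w [|k] //=; exact: eq_w. Qed.

Lemma eq_mj_state pi x th w w' N : (forall k, (k < N)%N -> w k = w' k) ->
  forall k, (k <= N)%N -> mj_state P pi x th w k = mj_state P pi x th w' k.
Proof.
move=> eq_w; elim=> [//|k IHk] kN /=.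
by rewrite IHk ?(ltnW kN)// (eq_mode th eq_w) ?(ltnW kN)// eq_w.
Qed.

Lemma eq_path_prob th w w' N : (forall k, (k < N)%N -> w k = w' k) ->
  path_prob P th w N = path_prob P th w' N.
Proof.
move=> eq_w; apply: eq_bigr => k _.
by rewrite (eq_mode th eq_w) ?(ltnW (ltn_ord k))// eq_w.
Qed.

Lemma eq_path_cost pi x th w w' N : (forall k, (k < N)%N -> w k = w' k) ->
  path_cost P pi x th w N = path_cost P pi x th w' N.
Proof.
move=> eq_w; apply: eq_bigr => k _.
have kN := ltnW (ltn_ord k).
by rewrite (eq_mode th eq_w)// (eq_mj_state pi x th eq_w)// eq_w.
Qed.

Lemma mode_recl (th : 'I_r) w k :
  mode th w k.+1 = mode (w 0%N) (fun k => w k.+1) k.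
Proof. by case: k. Qed.

Lemma mj_state_recl pi x th w k :
  mj_state P pi x th w k.+1 =
  mj_state P (fun k => pi k.+1) (mj_f P x th (pi 0%N x th) (w 0%N)) (w 0%N)
    (fun k => w k.+1) k.
Proof. by elim: k => [//|k IHk]; rewrite /= -IHk -(mode_recl th). Qed.

Lemma path_prob_recl th w N :
  path_prob P th w N.+1 =
  mj_p P th (w 0%N) * path_prob P (w 0%N) (fun k => w k.+1) N.
Proof.
rewrite /path_prob big_ord_recl; congr (_ * _); apply: eq_bigr => k _.
by rewrite -(mode_recl th).
Qed.

Lemma path_cost_recl pi x th w N :
  path_cost P pi x th w N.+1 =
  mj_g P x th (pi 0%N x th) (w 0%N) + mj_alpha P *
    path_cost P (fun k => pi k.+1) (mj_f P x th (pi 0%N x th) (w 0%N)) (w 0%N)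
      (fun k => w k.+1) N.
Proof.
rewrite /path_cost big_ord_recl expr0 mul1r mulr_sumr; congr (_ + _).
apply: eq_bigr => k _.
by rewrite mulrA -exprS -(mj_state_recl pi) -(mode_recl th).
Qed.

Lemma expected_cost0 pi x th : expected_cost P pi x th 0 = 0.
Proof. by apply: big1 => w _; rewrite /path_cost big_ord0 mulr0. Qed.

Hypothesis p_sum1 : forall i, \sum_(j < r) mj_p P i j = 1.

(** The default of [nth] is the initial mode, which changes from [th] to [i] after one stage; below
    [N] the default is never read. *)
Let nth_cons_tuple (th i : 'I_r) N (t : N.-tuple 'I_r) :
  forall k, (k < N)%N -> nth th (cons_tuple i t) k.+1 = nth i t k.
Proof. by move=> k kN /=; apply: set_nth_default; rewrite size_tuple. Qed.

Lemma sum_path_prob th N :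
  \sum_(w : N.-tuple 'I_r) path_prob P th (nth th w) N = 1.
Proof.
elim: N th => [|N IHN] th.
  rewrite (eq_bigr (fun=> 1)) => [|w _]; last exact: big_ord0.
  by rewrite sumr_const card_tuple expn0.
rewrite big_tuple_cons -[RHS](p_sum1 th); apply: eq_bigr => i _.
rewrite -[RHS]mulr1 -(IHN i) mulr_sumr; apply: eq_bigr => t _.
by rewrite path_prob_recl (eq_path_prob _ (nth_cons_tuple th i t)).
Qed.

Lemma expected_cost_recl pi x th N :
  expected_cost P pi x th N.+1 =
  \sum_(w < r) mj_p P th w * (mj_g P x th (pi 0%N x th) w + mj_alpha P *
    expected_cost P (fun k => pi k.+1) (mj_f P x th (pi 0%N x th) w) w N).
Proof.
rewrite /expected_cost big_tuple_cons; apply: eq_bigr => i _.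
(* Writing 1 as the total probability of the remaining paths spreads the first-stage cost over all
   tails [t]. *)
rewrite -[mj_g _ _ _ _ _]mul1r -(sum_path_prob i N) mulr_suml mulr_sumr.
rewrite -big_split /= mulr_sumr; apply: eq_bigr => t _.
rewrite path_prob_recl path_cost_recl.
rewrite (eq_path_prob _ (nth_cons_tuple th i t)).
rewrite (eq_path_cost _ _ _ (nth_cons_tuple th i t)) /=.
by rewrite -mulrA mulrDr [in RHS]mulrCA.
Qed.

End ExpectedCost.

(** * Limits of real sequences in the extended reals, and of matrices by entries *)

Section NondecreasingLimit.
Variables (R : realType) (u v : nat -> R) (l : R).
Hypothesis u_nd : forall N, u N <= u N.+1.
Hypothesis v_le_u : forall N, v N <= u N.
Hypothesis v_cvg : v @ \oo --> l.

Let u_homo : {homo (fun N => (u N)%:E) : m p / (m <= p)%N >-> (m <= p)%E}.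
Proof.
by move=> m p mp; rewrite lee_fin; move: m p mp; exact/nondecreasing_seqP.
Qed.

Lemma le_limn_EFin : (l%:E <= limn (fun N => (u N)%:E))%E.
Proof.
have v_cvgE : (v N)%:E @[N --> \oo] --> l%:E by apply: cvg_EFin => //; near=> N.
rewrite -(cvg_lim _ v_cvgE)//; apply: lee_lim.
- by apply/cvg_ex; exists l%:E.
- exact: ereal_nondecreasing_is_cvgn.
- by near=> N; rewrite lee_fin.
Unshelve. all: by end_near. Qed.

(** The minorant [v] already forces the limit to be at least [l], so equality only requires that no
    term exceed [l]. This turns attainment of an optimal cost into inequalities at finite
    horizons. *)
Lemma limn_EFin_eqP :
  limn (fun N => (u N)%:E) = l%:E <-> forall N, u N <= l.
Proof.
split=> [lim_u N|u_le].
  rewrite -lee_fin -lim_u (cvg_lim _ (ereal_nondecreasing_cvgn u_homo))//.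
  by apply: ereal_sup_ubound; exists N.
apply/eqP; rewrite eq_le le_limn_EFin andbT; apply: lime_le.
  exact: ereal_nondecreasing_is_cvgn.
by near=> N; rewrite lee_fin.
Unshelve. all: by end_near. Qed.

End NondecreasingLimit.

(** A neighbourhood of a matrix contains a product of neighbourhoods of its finitely many
    entries. *)
Lemma cvg_mx_coord (R : realType) (n r : nat) (u : nat -> 'M[R]_(n, r))
    (c : 'M[R]_(n, r)) :
  (forall i j, u N i j @[N --> \oo] --> c i j) -> u N @[N --> \oo] --> c.
Proof.
move=> u_cvg A [Q Qnbhs QA].
have uQ : \forall N \near \oo, forall i j, Q i j (u N i j).
  apply: filter_forall => i; apply: filter_forall => j.
  exact: (u_cvg i j _ (Qnbhs i j)).
by near=> N; apply: QA; near: N.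
Unshelve. all: by end_near. Qed.

(** * Inner products, and affine recursions with a stable matrix *)

Section DotProduct.
Variables (R : realType) (n : nat).
Implicit Types (a b x : 'cV[R]_n).

Lemma dotvE a x : dotv a x = \sum_(i < n) a i 0 * x i 0.
Proof. by rewrite /dotv mxE; apply: eq_bigr => i _; rewrite mxE. Qed.

Lemma dotvDl a b x : dotv (a + b) x = dotv a x + dotv b x.
Proof. by rewrite /dotv linearD mulmxDl mxE. Qed.

Lemma dotvZl k a x : dotv (k *: a) x = k * dotv a x.
Proof. by rewrite /dotv linearZ -scalemxAl mxE. Qed.

Lemma dotvZr k a x : dotv a (k *: x) = k * dotv a x.
Proof. by rewrite /dotv -scalemxAr mxE. Qed.

Lemma dotv_suml (I : finType) (F : I -> 'cV[R]_n) x :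
  dotv (\sum_i F i) x = \sum_i dotv (F i) x.
Proof. by rewrite /dotv raddf_sum mulmx_suml summxE. Qed.

Lemma dotv_sumr (I : finType) a (F : I -> 'cV[R]_n) :
  dotv a (\sum_i F i) = \sum_i dotv a (F i).
Proof. by rewrite /dotv mulmx_sumr summxE. Qed.

Lemma dotv0l x : dotv 0 x = 0.
Proof. by rewrite /dotv trmx0 mul0mx mxE. Qed.

Lemma dotv0r a : dotv a 0 = 0.
Proof. by rewrite /dotv mulmx0 mxE. Qed.

Lemma dotv_trmx (A : 'M[R]_n) a x : dotv (A^T *m a) x = dotv a (A *m x).
Proof. by rewrite /dotv trmx_mul trmxK mulmxA. Qed.

Lemma dotv_delta a i : dotv a (delta_mx i 0) = a i 0.
Proof.
rewrite dotvE (bigD1 i)//= mxE !eqxx mulr1 big1 ?addr0// => j /negPf ji.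
by rewrite mxE ji mulr0.
Qed.

Lemma le_dotv a b x : nonneg_mx x -> (forall i, a i 0 <= b i 0) ->
  dotv a x <= dotv b x.
Proof. by move=> x0 ab; rewrite !dotvE ler_sum// => i _; rewrite ler_wpM2r. Qed.

Lemma cvg_dotv (r : nat) (u : nat -> 'M[R]_(n, r)) (c : 'M[R]_(n, r)) x j :
  (forall i, u N i j @[N --> \oo] --> c i j) ->
  dotv (col j (u N)) x @[N --> \oo] --> dotv (col j c) x.
Proof.
move=> u_cvg; rewrite dotvE; under eq_fun do rewrite dotvE.
apply: cvg_big => [|i _]; first exact: add_continuous.
by under eq_fun do rewrite mxE; rewrite mxE; exact: cvgM (u_cvg i) (cvg_cst _).
Qed.

End DotProduct.

(** Unrolling from 0 gives [y N] as the sum of [q *m M ^+ k] over [k < N], bounded by summability of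
    the entries of [M ^+ k]. *)
Lemma stable_affine_bounded (R : realType) (m : nat) (M : 'M[R]_m)
    (q : 'rV[R]_m) (y : nat -> 'rV[R]_m) :
  stable M -> y 0%N = 0 -> (forall k, y k.+1 = q + y k *m M) ->
  forall j, exists B, forall k, y k 0 j <= B.
Proof.
move=> stM y0 yS j.
have yE N : y N = \sum_(k < N) q *m M ^+ k.
  elim: N => [|N IHN]; first by rewrite big_ord0.
  rewrite yS IHN big_ord_recl expr0 mulmx1; congr (_ + _).
  rewrite mulmx_suml; apply: eq_bigr => k _.
  by rewrite -mulmxA /= exprSr.
have [B hB] := choice (fun i => stable_summable stM i j).
exists (\sum_i `|q 0 i| * B i) => N; rewrite yE summxE.
under eq_bigr do rewrite mxE.
rewrite exchange_big ler_sum//= => i _; rewrite -mulr_sumr.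
apply: le_trans (ler_norm _) _; rewrite normrM ler_wpM2l//.
exact: le_trans (ler_norm_sum _ _ _) (hB i N).
Qed.

Lemma scale_mxrow (R : pzRingType) (m q : nat) (q_ : 'I_q -> nat) (a : R)
    (B : forall j : 'I_q, 'M[R]_(m, q_ j)) :
  a *: \mxrow_j B j = \mxrow_j (a *: B j).
Proof. by apply/matrixP => i j; rewrite !mxE. Qed.

(** * Policy evaluation on linear cost functions *)

Section Semilinear.
Variables (R : realType) (n r : nat) (C : Type) (P : mjproblem R n r C).
Hypothesis hsl : mj_semilinear P.

Local Notation alpha := (mj_alpha P).
Local Notation p := (mj_p P).

Let alpha_ge0 : 0 <= alpha.
Proof. by have /andP[/ltW] := sl_alpha hsl. Qed.

Lemma le_Qfactor (c d : 'M[R]_(n, r)) x th u : mj_X P x -> mj_U P x th u ->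
  (forall i j, c i j <= d i j) -> Qfactor P c x th u <= Qfactor P d x th u.
Proof.
move=> Xx Uu cd; apply: ler_sum => w _.
rewrite ler_wpM2l ?(sl_p_ge0 hsl)// lerD2l ler_wpM2l// le_dotv//.
  exact/(sl_X_ge0 hsl)/(sl_f_X hsl).
by move=> i; rewrite !mxE.
Qed.

(** The Bellman operator of the fixed policy [mu] on coefficients; the transpose lets [mj_A] act on
    [c] instead of on the state. *)
Definition policy_map (mu : 'cV[R]_n -> 'I_r -> C) (c : 'M[R]_(n, r)) :
    'M[R]_(n, r) :=
  \matrix_(i < n, th < r) (\sum_(w < r) p th w *:
    (mj_q P mu th w + alpha *: ((mj_A P mu th w)^T *m col w c))) i 0.

Lemma col_policy_map mu c th : col th (policy_map mu c) =
  \sum_(w < r) p th w *: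
    (mj_q P mu th w + alpha *: ((mj_A P mu th w)^T *m col w c)).
Proof. by apply/matrixP => i j; rewrite [j]ord1 !mxE. Qed.

Lemma dotv_policy_map mu c x th : mj_Mhat P mu -> mj_X P x ->
  dotv (col th (policy_map mu c)) x = Qfactor P c x th (mu x th).
Proof.
move=> Mmu Xx; rewrite col_policy_map dotv_suml; apply: eq_bigr => w _.
rewrite dotvZl dotvDl dotvZl dotv_trmx.
by rewrite (sl_f_linear hsl)// (sl_g_linear hsl).
Qed.

Lemma le_policy_map mu (c d : 'M[R]_(n, r)) : mj_Mhat P mu ->
  (forall i j, c i j <= d i j) ->
  forall i j, policy_map mu c i j <= policy_map mu d i j.
Proof.
move=> Mmu cd i j; rewrite !mxE !summxE; apply: ler_sum => w _.
rewrite !mxE ler_wpM2l ?(sl_p_ge0 hsl)// lerD2l ler_wpM2l//.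
apply: ler_sum => k _; rewrite !mxE ler_wpM2l//.
exact: (sl_A_ge0 hsl).
Qed.

(** The weights sum to 1, so the constant term is reproduced. The factor [k] may exceed 1, as the
    uniqueness argument requires. *)
Lemma policy_map_affine mu (k : R) (a b : 'M[R]_(n, r)) :
  policy_map mu (k *: a + (1 - k) *: b) =
  k *: policy_map mu a + (1 - k) *: policy_map mu b.
Proof.
apply/matrixP => i j; rewrite !mxE !summxE !mulr_sumr -big_split /=.
apply: eq_bigr => w _.
have -> : col w (k *: a + (1 - k) *: b) = k *: col w a + (1 - k) *: col w b.
  by apply/matrixP => i' j'; rewrite !mxE.
rewrite mulmxDr -!scalemxAr.
move: (_ *m col w a) (_ *m col w b) => Aa Ab; rewrite !mxE.
ring.
Qed.

(** Laying the transposed columns of [c] side by side in one row makes [policy_map] an affine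
    recursion: block [(w, k)] of [Abar] is [p k w] times [mj_A P mu k w], so the row is multiplied
    on the right by [alpha *: Abar P mu]. *)
Lemma iter_policy_map_bounded mu : stable (alpha *: Abar P mu) ->
  forall i j, exists B, forall N, iter N (policy_map mu) 0 i j <= B.
Proof.
move=> st i j.
pose row (c : 'M[R]_(n, r)) : 'rV_(\sum_(k < r) n) :=
  \mxrow_(k < r) (col k c)^T.
have row_map c : row (policy_map mu c) =
    row (policy_map mu 0) + row c *m (alpha *: Abar P mu).
  rewrite -scalemxAr /row mul_mxrow_mxblock scale_mxrow -mxrowD.
  apply: eq_mxrow => k; rewrite !col_policy_map !linear_sum -big_split /=.
  apply: eq_bigr => w _; rewrite col0 mulmx0 scaler0 addr0.
  rewrite scalerDr linearD /=; congr (_ + _).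
  rewrite !linearZ /= trmx_mul trmxK.
  by rewrite !scalerA mulrC.
have row0 : row 0 = 0.
  by apply/mxrowP => k; rewrite mxrowK submxrow0 col0 trmx0.
(* [tagnat.Rank j i] is the position of entry [i] of block [j] in the stacked row. *)
have [B hB] := stable_affine_bounded
  (y := fun N => row (iter N (policy_map mu) 0)) st row0
  (fun N => row_map _) (tagnat.Rank j i).
exists B => N; apply: le_trans (hB N).
have /matrixP/(_ 0 i) :=
  mxrowK (fun k => (col k (iter N (policy_map mu) 0))^T) j.
by rewrite !mxE => ->.
Qed.

Lemma lift_policy_U mu xb : mj_Mhat P mu -> Xbar P xb ->
  Ubar P xb (lift_policy mu xb).
Proof. by move=> Mmu Xxb th; exact: (sl_Mhat_policy hsl). Qed.

(** The link between the two problems. Component [th] of [fbar] gathers the transitions into [th];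
    exchanging the sums regroups them by the mode they leave. *)
Lemma sum_Qfactor c xb ub :
  \sum_(th < r) Qfactor P c (xb th) th (ub th) =
  gbar P xb ub + alpha * \sum_(th < r) dotv (col th c) (fbar P xb ub th).
Proof.
have -> : \sum_(th < r) dotv (col th c) (fbar P xb ub th) =
    \sum_(th < r) \sum_(w < r)
      p th w * dotv (col w c) (mj_f P (xb th) th (ub th) w).
  rewrite exchange_big; apply: eq_bigr => w _; rewrite dotv_sumr.
  by apply: eq_bigr => th _; rewrite dotvZr.
rewrite mulr_sumr -big_split; apply: eq_bigr => th _.
rewrite mulr_sumr -big_split; apply: eq_bigr => w _ /=.
by rewrite mulrDr mulrCA.
Qed.

End Semilinear.

(** * Monotone value iteration and its limit *)

Section ValueIteration.
Variables (R : realType) (n r : nat) (C : Type) (P : mjproblem R n r C).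
Hypothesis hsl : mj_semilinear P.
Hypothesis hclosure : closure_attainability P.
Hypothesis hstate : state_space_structure P.

Local Notation alpha := (mj_alpha P).
Local Notation G := (Gbar P).
Local Notation T := (policy_map P).

(** These test states let inequalities between linear functions on [mj_X P] be read
    coordinatewise. *)
Lemma scaled_basis_in_X : exists2 s : R, 0 < s &
  forall i, mj_X P (s *: delta_mx i 0).
Proof.
have [s s0 sX] := hstate; exists s => // i; apply: sX => [j k|].
  by rewrite !mxE mulr_ge0 ?ler0n ?ltW.
rewrite (bigD1 i)//= !mxE !eqxx mulr1 big1 ?addr0// => j /negPf ji.
by rewrite !mxE ji mulr0.
Qed.

Lemma zero_in_X : mj_X P 0.
Proof.
have [s s0 sX] := hstate; apply: sX => [i j|]; first by rewrite mxE.
by rewrite big1 ?ltW// => i _; rewrite mxE.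
Qed.

Lemma le_on_X (c d : 'M[R]_(n, r)) th :
  (forall x, mj_X P x -> dotv (col th c) x <= dotv (col th d) x) ->
  forall i, c i th <= d i th.
Proof.
move=> cd i; have [s s0 sX] := scaled_basis_in_X.
by have := cd _ (sX i); rewrite !dotvZr !dotv_delta !mxE ler_pM2l.
Qed.

Lemma eq_on_X (c d : 'M[R]_(n, r)) :
  (forall x th, mj_X P x -> dotv (col th c) x = dotv (col th d) x) -> c = d.
Proof.
move=> cd; apply/matrixP => i j; apply/eqP; rewrite eq_le.
by apply/andP; split; apply: le_on_X => x Xx; rewrite cd.
Qed.

Lemma GbarP c : Cset c -> bellman_image P c (G c).
Proof.
have [exU _ _] := hclosure => c0; have [d [dP _]] := exU c c0.
by apply: xgetPex; exists d.
Qed.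

Lemma Gbar_ge0 c : Cset c -> Cset (G c).
Proof. by move=> /GbarP[]. Qed.

Lemma Gbar_le_Qfactor c x th u : Cset c -> mj_X P x -> mj_U P x th u ->
  dotv (col th (G c)) x <= Qfactor P c x th u.
Proof.
by move=> /GbarP[_ minG] Xx Uu; have [_] := minG x th Xx; apply; exists u.
Qed.

(** A control minimizing for [d] is also feasible for [c], where its Q-factor is no larger. *)
Lemma le_Gbar c d : Cset c -> Cset d -> (forall i j, c i j <= d i j) ->
  forall i j, G c i j <= G d i j.
Proof.
move=> c0 d0 cd i j; apply: le_on_X => x Xx.
have [_ /(_ x j Xx)[[u Uu <-] _]] := GbarP d0.
exact: le_trans (Gbar_le_Qfactor c0 Xx Uu) (le_Qfactor hsl Xx Uu cd).
Qed.

Lemma Gbar_le_policy_map mu c : mj_Mhat P mu -> Cset c ->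
  forall i j, G c i j <= T mu c i j.
Proof.
move=> Mmu c0 i j; apply: le_on_X => x Xx.
rewrite (dotv_policy_map hsl)//; apply: Gbar_le_Qfactor => //.
exact: (sl_Mhat_policy hsl).
Qed.

(** Attainability gives one minimizing policy per mode; the Cartesian product condition glues them
    into a single policy of [mj_Mhat P]. *)
Lemma Gbar_attained c : cartesian_product P -> Cset c ->
  exists2 mu, mj_Mhat P mu & G c = T mu c.
Proof.
move=> hcart c0; have [_ _ att] := hclosure.
have /choice[m mP] : forall th, exists mu, mj_Mhat P mu /\
    forall x, mj_X P x -> is_minimum [set Qfactor P c x th u | u in mj_U P x th]
                           (Qfactor P c x th (mu x th)).
  by move=> th; have [mu Mmu muP] := att c c0 th; exists mu.
have Mmu : mj_Mhat P (fun x th => m th x th).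
  by apply: hcart => th; have [] := mP th.
exists (fun x th => m th x th) => //; apply: eq_on_X => x th Xx.
rewrite (dotv_policy_map hsl)//; apply/eqP; rewrite eq_le.
have [_ /(_ x Xx)[mU lbm]] := mP th.
have [_ /(_ x th Xx)[GU lbG]] := GbarP c0.
by rewrite lbG ?lbm.
Qed.

Local Notation vi N := (iter N G 0).

Let Cset0 : Cset (0 : 'M[R]_(n, r)).
Proof. by move=> i j; rewrite mxE. Qed.

Lemma vi_ge0 N : Cset (vi N).
Proof. by elim: N => [|N IHN] //=; exact: Gbar_ge0. Qed.

Lemma vi_le_viS N i j : vi N i j <= vi N.+1 i j.
Proof.
elim: N i j => [|N IHN] i j; first by rewrite [leLHS]mxE; exact: vi_ge0.
by rewrite /= le_Gbar//; [exact: vi_ge0|exact: Gbar_ge0 (vi_ge0 N)].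
Qed.

Lemma vi_le_fixpoint c N i j : Cset c -> c = G c -> vi N i j <= c i j.
Proof.
move=> c0 cG; elim: N i j => [|N IHN] i j; first by rewrite mxE; exact: c0.
by rewrite cG /=; apply: le_Gbar => //; exact: vi_ge0.
Qed.

Lemma vi_le_iter_policy_map mu N i j : mj_Mhat P mu ->
  vi N i j <= iter N (T mu) 0 i j.
Proof.
move=> Mmu; elim: N i j => [|N IHN] i j //=.
apply: le_trans (Gbar_le_policy_map Mmu (vi_ge0 N) i j) _.
exact: le_policy_map.
Qed.

Lemma vi_cvg : stabilizability P -> exists c, [/\ Cset c, c = G c &
  forall i j, vi N i j @[N --> \oo] --> c i j].
Proof.
move=> [mu Mmu st].
pose c : 'M[R]_(n, r) := \matrix_(i, j) limn (fun N => vi N i j).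
have nd_vi i j : {homo (fun N => vi N i j) : m k / (m <= k)%N >-> m <= k}.
  by apply/nondecreasing_seqP => N; exact: vi_le_viS.
have cvg_vi i j : cvgn (fun N => vi N i j).
  apply: nondecreasing_is_cvgn => //.
  have [B hB] := iter_policy_map_bounded st i j.
  exists B => _ [N _ <-].
  exact: le_trans (vi_le_iter_policy_map N i j Mmu) (hB N).
have c0 : Cset c.
  move=> i j; rewrite mxE.
  have := nondecreasing_cvgn_le (nd_vi i j) (cvg_vi i j) 0%N.
  by rewrite /= mxE.
have vi_c i j : vi N i j @[N --> \oo] --> c i j by rewrite mxE; exact: cvg_vi.
exists c; split=> //.
have [_ /subspace_continuousP contG _] := hclosure.
(* Continuity of [Gbar] is within [Cset], so the neighbourhood condition is conditional on
   membership, which [vi_ge0] supplies. *)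
have Gvi_c : G (vi N) @[N --> \oo] --> G c.
  apply: cvg_comp (contG c c0) => A wA.
  have vi_A : \forall N \near \oo, Cset (vi N) -> A (vi N).
    exact: cvg_mx_coord vi_c _ wA.
  by apply: filterS vi_A => N; apply; exact: vi_ge0.
(* Both [c] and [G c] are limits of the shifted sequence, hence equal. *)
have viS_c : vi N.+1 @[N --> \oo] --> c.
  by have := cvg_mx_coord vi_c; rewrite -cvg_shiftS.
exact: cvg_unique viS_c Gvi_c.
Qed.
End ValueIteration.

(** * Finite-horizon costs of both problems *)

Section Costs.
Variables (R : realType) (n r : nat) (C : Type) (P : mjproblem R n r C).
Hypothesis hsl : mj_semilinear P.
Hypothesis hdet : deterministic_wf P.
Hypothesis hclosure : closure_attainability P.
Hypothesis hstate : state_space_structure P.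

Local Notation alpha := (mj_alpha P).
Local Notation T := (policy_map P).
Local Notation vi N := (iter N (Gbar P) 0).

Let alpha_ge0 : 0 <= alpha.
Proof. by have /andP[/ltW] := sl_alpha hsl. Qed.

Lemma admissible_behead pi : admissible P pi ->
  admissible P (fun k => pi k.+1).
Proof. by move=> adm k; exact: adm. Qed.

Lemma admissible_const mu : mj_Mhat P mu -> admissible P (fun=> mu).
Proof. by move=> Mmu k; exact: (sl_Mhat_policy hsl). Qed.

(** The induction varies [pi], because the shifted sequence is followed after the first stage; the
    Q-factor of any first control is at least the minimum. *)
Lemma vi_le_expected_cost pi N x th : admissible P pi -> mj_X P x ->
  dotv (col th (vi N)) x <= expected_cost P pi x th N.
Proof.
elim: N pi x th => [|N IHN] pi x th adm Xx.
  by rewrite expected_cost0 col0 dotv0l.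
have Uu := adm 0%N x th Xx.
rewrite (expected_cost_recl (sl_p_sum1 hsl)).
apply: le_trans (Gbar_le_Qfactor hclosure (vi_ge0 hclosure N) Xx Uu) _.
apply: ler_sum => w _; rewrite ler_wpM2l ?(sl_p_ge0 hsl)// lerD2l ler_wpM2l//.
by apply: IHN; [exact: admissible_behead|exact: (sl_f_X hsl)].
Qed.

(** Nonnegative stage costs give the base case; the recursion on the first stage avoids comparing
    sums over tuples of different lengths. *)
Lemma expected_cost_leS pi N x th : admissible P pi -> mj_X P x ->
  expected_cost P pi x th N <= expected_cost P pi x th N.+1.
Proof.
elim: N pi x th => [|N IHN] pi x th adm Xx.
  rewrite expected_cost0 (expected_cost_recl (sl_p_sum1 hsl)) sumr_ge0// => w _.
  rewrite mulr_ge0 ?(sl_p_ge0 hsl)// expected_cost0 mulr0 addr0.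
  exact/(sl_g_ge0 hsl)/adm.
rewrite 2!(expected_cost_recl (sl_p_sum1 hsl)).
apply: ler_sum => w _; rewrite ler_wpM2l ?(sl_p_ge0 hsl)// lerD2l ler_wpM2l//.
by apply: IHN; [exact: admissible_behead|exact/(sl_f_X hsl)/adm].
Qed.

Lemma expected_cost_policy mu N x th : mj_Mhat P mu -> mj_X P x ->
  expected_cost P (fun=> mu) x th N = dotv (col th (iter N (T mu) 0)) x.
Proof.
move=> Mmu; elim: N x th => [|N IHN] x th Xx.
  by rewrite expected_cost0 col0 dotv0l.
rewrite (expected_cost_recl (sl_p_sum1 hsl)) /= (dotv_policy_map hsl)//.
apply: eq_bigr => w _; rewrite IHN//.
exact/(sl_f_X hsl)/(sl_Mhat_policy hsl).
Qed.

Definition det_partial_cost (u : nat -> 'I_r -> C) xb N : R :=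
  \sum_(0 <= k < N) alpha ^+ k * gbar P (det_state P u xb k) (u k).

Lemma det_costE u xb :
  det_cost P u xb = limn (fun N => (det_partial_cost u xb N)%:E).
Proof. by congr (limn _); apply/funext => N; rewrite sumEFin. Qed.

Lemma det_state_recl u xb k : det_state P u xb k.+1 =
  det_state P (fun k => u k.+1) (fbar P xb (u 0%N)) k.
Proof. by elim: k => [//|k IHk]; rewrite /= -IHk. Qed.

Lemma det_partial_cost_recl u xb N : det_partial_cost u xb N.+1 =
  gbar P xb (u 0%N) + alpha *
    det_partial_cost (fun k => u k.+1) (fbar P xb (u 0%N)) N.
Proof.
rewrite /det_partial_cost big_nat_recl// expr0 mul1r mulr_sumr; congr (_ + _).
by apply: eq_bigr => k _; rewrite det_state_recl exprS mulrA.
Qed.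

Lemma det_state_X u xb k : Xbar P xb -> det_admissible P xb u ->
  Xbar P (det_state P u xb k).
Proof. by move=> Xxb adm; elim: k => [//|k IHk]; exact: hdet. Qed.

Lemma det_admissible_behead u xb : det_admissible P xb u ->
  det_admissible P (fbar P xb (u 0%N)) (fun k => u k.+1).
Proof. by move=> adm k; rewrite -det_state_recl; exact: adm. Qed.

Lemma vi_le_det_partial_cost u N xb : Xbar P xb -> det_admissible P xb u ->
  \sum_(th < r) dotv (col th (vi N)) (xb th) <= det_partial_cost u xb N.
Proof.
elim: N u xb => [|N IHN] u xb Xxb adm.
  rewrite /det_partial_cost big_geq// big1// => th _.
  by rewrite col0 dotv0l.
have Uu : Ubar P xb (u 0%N) := adm 0%N.
rewrite det_partial_cost_recl.
apply: (@le_trans _ _ (\sum_(th < r) Qfactor P (vi N) (xb th) th (u 0%N th))).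
  apply: ler_sum => th _; apply: Gbar_le_Qfactor => //; exact: vi_ge0.
rewrite sum_Qfactor lerD2l ler_wpM2l// IHN//; first exact: hdet.
exact: det_admissible_behead.
Qed.

Lemma det_partial_cost_leS u N xb : Xbar P xb -> det_admissible P xb u ->
  det_partial_cost u xb N <= det_partial_cost u xb N.+1.
Proof.
move=> Xxb adm; rewrite /det_partial_cost big_nat_recr//= lerDl.
rewrite mulr_ge0 ?exprn_ge0// sumr_ge0// => th _; rewrite sumr_ge0// => w _.
rewrite mulr_ge0 ?(sl_p_ge0 hsl)// (sl_g_ge0 hsl)//.
  exact: det_state_X.
exact: adm.
Qed.

(** The control sequence evaluated by [det_policy_cost], named so that its tail is recognizable as
    the closed loop from the next state. *)
Definition closed_loop (nu : ('I_r -> 'cV[R]_n) -> 'I_r -> C) xb :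
    nat -> 'I_r -> C :=
  fun k => nu (iter k (fun yb => fbar P yb (nu yb)) xb).

Lemma det_state_closed_loop nu xb k :
  det_state P (closed_loop nu xb) xb k =
  iter k (fun yb => fbar P yb (nu yb)) xb.
Proof. by elim: k => [//|k IHk] /=; rewrite IHk. Qed.

Lemma closed_loop_admissible mu xb : mj_Mhat P mu -> Xbar P xb ->
  det_admissible P xb (closed_loop (lift_policy mu) xb).
Proof.
move=> Mmu Xxb k; rewrite det_state_closed_loop.
apply: lift_policy_U => //; elim: k => [//|k IHk] /=.
by apply: hdet => //; exact: lift_policy_U.
Qed.

Lemma closed_loop_behead nu xb :
  (fun k => closed_loop nu xb k.+1) = closed_loop nu (fbar P xb (nu xb)).
Proof. by apply/funext => k; rewrite /closed_loop iterSr. Qed.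

Lemma det_partial_cost_policy mu N xb : mj_Mhat P mu -> Xbar P xb ->
  det_partial_cost (closed_loop (lift_policy mu) xb) xb N =
  \sum_(th < r) dotv (col th (iter N (T mu) 0)) (xb th).
Proof.
move=> Mmu; elim: N xb => [|N IHN] xb Xxb.
  rewrite /det_partial_cost big_geq// big1// => th _.
  by rewrite col0 dotv0l.
have Uxb := lift_policy_U hsl Mmu Xxb.
rewrite det_partial_cost_recl closed_loop_behead IHN; last exact: hdet.
rewrite -sum_Qfactor; apply: eq_bigr => th _.
by rewrite (dotv_policy_map hsl).
Qed.

(** * Optimal costs, optimal policies and uniqueness of the fixed point *)

Section FixedPoint.
Variable c : 'M[R]_(n, r).
Hypothesis c_ge0 : Cset c.
Hypothesis vi_c : forall i j, vi N i j @[N --> \oo] --> c i j.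

Let vi_dotv x th : dotv (col th (vi N)) x @[N --> \oo] --> dotv (col th c) x.
Proof. exact: cvg_dotv. Qed.

Let vi_sum (xb : 'I_r -> 'cV[R]_n) :
  \sum_(th < r) dotv (col th (vi N)) (xb th) @[N --> \oo] -->
  \sum_(th < r) dotv (col th c) (xb th).
Proof.
by apply: cvg_big => [|th _]; [exact: add_continuous|exact: cvg_dotv].
Qed.

Lemma le_mj_cost pi x th : admissible P pi -> mj_X P x ->
  ((dotv (col th c) x)%:E <= mj_cost P pi x th)%E.
Proof.
move=> adm Xx.
apply: (le_limn_EFin _ _ (@vi_dotv x th)) => N.
  exact: expected_cost_leS.
exact: vi_le_expected_cost.
Qed.

Lemma le_det_cost u xb : Xbar P xb -> det_admissible P xb u ->
  ((\sum_(th < r) dotv (col th c) (xb th))%:E <= det_cost P u xb)%E.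
Proof.
move=> Xxb adm; rewrite det_costE.
apply: (le_limn_EFin _ _ (@vi_sum xb)) => N.
  exact: det_partial_cost_leS.
exact: vi_le_det_partial_cost.
Qed.

(** The N-stage costs of [mu] lie above value iterates that tend to the cost given by [c], so
    [limn_EFin_eqP] applies. *)
Lemma mj_cost_policyP mu x th : mj_Mhat P mu -> mj_X P x ->
  mj_cost P (fun=> mu) x th = (dotv (col th c) x)%:E <->
  forall N, dotv (col th (iter N (T mu) 0)) x <= dotv (col th c) x.
Proof.
move=> Mmu Xx; have adm := admissible_const Mmu.
have iffP := limn_EFin_eqP (fun N => expected_cost_leS N th adm Xx)
  (fun N => vi_le_expected_cost N th adm Xx) (@vi_dotv x th).
split=> [/iffP le_c N|le_c]; first by rewrite -expected_cost_policy.
by apply/iffP => N; rewrite expected_cost_policy.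
Qed.

Lemma det_cost_policyP mu xb : mj_Mhat P mu -> Xbar P xb ->
  det_policy_cost P (lift_policy mu) xb =
    (\sum_(th < r) dotv (col th c) (xb th))%:E <->
  forall N, \sum_(th < r) dotv (col th (iter N (T mu) 0)) (xb th) <=
    \sum_(th < r) dotv (col th c) (xb th).
Proof.
move=> Mmu Xxb; have adm := closed_loop_admissible Mmu Xxb.
rewrite /det_policy_cost -/(closed_loop _ _) det_costE.
have iffP := limn_EFin_eqP (fun N => det_partial_cost_leS N Xxb adm)
  (fun N => vi_le_det_partial_cost N Xxb adm) (@vi_sum xb).
split=> [/iffP le_c N|le_c]; first by rewrite -det_partial_cost_policy.
by apply/iffP => N; rewrite det_partial_cost_policy.
Qed.

Lemma iter_policy_map_le mu : mj_Mhat P mu -> c = T mu c ->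
  forall N i j, iter N (T mu) 0 i j <= c i j.
Proof.
move=> Mmu cT; elim=> [|N IHN] i j; first by rewrite mxE; exact: c_ge0.
by rewrite cT /=; exact: le_policy_map.
Qed.

Variable mu : 'cV[R]_n -> 'I_r -> C.
Hypothesis mu_Mhat : mj_Mhat P mu.
Hypothesis mu_c : c = T mu c.

Let mu_le x th N : mj_X P x ->
  dotv (col th (iter N (T mu) 0)) x <= dotv (col th c) x.
Proof.
move=> Xx; apply: le_dotv; first exact: (sl_X_ge0 hsl).
by move=> i; rewrite !mxE iter_policy_map_le.
Qed.

(** [le_mj_cost] bounds all admissible costs from below, and [mu] attains the bound. *)
Lemma JstarE x th : mj_X P x -> Jstar P x th = (dotv (col th c) x)%:E.
Proof.
move=> Xx; apply/eqP; rewrite eq_le; apply/andP; split.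
  apply: ereal_inf_lbound; exists (fun=> mu); first exact: admissible_const.
  by apply/mj_cost_policyP => // N; exact: mu_le.
by apply: le_ereal_inf_tmp => _ [pi adm <-]; exact: le_mj_cost.
Qed.

Lemma JbarstarE xb : Xbar P xb ->
  Jbarstar P xb = (\sum_(th < r) dotv (col th c) (xb th))%:E.
Proof.
move=> Xxb; apply/eqP; rewrite eq_le; apply/andP; split.
  apply: ereal_inf_lbound; exists (closed_loop (lift_policy mu) xb).
    exact: closed_loop_admissible.
  by apply/det_cost_policyP => // N; apply: ler_sum => th _; exact: mu_le.
by apply: le_ereal_inf_tmp => _ [u adm <-]; exact: le_det_cost.
Qed.

Lemma mj_optimal_fixpoint : mj_optimal P mu.
Proof.
move=> x th Xx; rewrite JstarE//; apply/mj_cost_policyP => // N.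
exact: mu_le.
Qed.

(** In both problems optimality says that no N-stage cost of [nu] exceeds the cost given by [c]. One
    direction sums these bounds over the modes, the other isolates a mode. *)
Lemma mj_optimal_iff_det_optimal nu : mj_Mhat P nu ->
  (mj_optimal P nu <-> det_optimal P (lift_policy nu)).
Proof.
move=> Mnu; split=> [opt xb Xxb|opt x th Xx].
  rewrite JbarstarE//; apply/det_cost_policyP => // N.
  apply: ler_sum => th _; move: N; apply/mj_cost_policyP => //.
  by rewrite opt ?JstarE.
rewrite JstarE//; apply/mj_cost_policyP => // N.
(* Placing [x] in mode [th] and 0 elsewhere leaves a single summand. *)
pose xb th' : 'cV[R]_n := if th' == th then x else 0.
have Xxb : Xbar P xb.
  by move=> th'; rewrite /xb; case: eqP => // _; exact: zero_in_X.
have sum_xb d : \sum_(th' < r) dotv (col th' d) (xb th') = dotv (col th d) x.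
  rewrite (bigD1 th)//= /xb eqxx big1 ?addr0// => th' /negPf ->.
  exact: dotv0r.
have := opt xb Xxb; rewrite JbarstarE// => /det_cost_policyP.
by move=> /(_ Mnu Xxb N); rewrite !sum_xb.
Qed.

(** At a small multiple [s] of basis vector [i] in mode [th], the cost [s * c i th] dominates the
    N-stage cost of [mu], hence the positive N-stage optimum. *)
Lemma fixpoint_gt0 : observability P -> forall i j, 0 < c i j.
Proof.
move=> [N obs] i th; have [s s0 sX] := scaled_basis_in_X hstate.
have Xx := sX i.
have x_neq0 : s *: delta_mx i 0 != 0 :> 'cV[R]_n.
  apply/eqP => /matrixP/(_ i 0); rewrite !mxE !eqxx mulr1 => /eqP.
  by rewrite gt_eqF.
have cost_gt0 : 0 < expected_cost P (fun=> mu) (s *: delta_mx i 0) th N.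
  rewrite -lte_fin; apply: lt_le_trans (obs _ th Xx x_neq0) _.
  by apply: ereal_inf_lbound; exists (fun=> mu) => //; exact: admissible_const.
rewrite expected_cost_policy// in cost_gt0.
have := lt_le_trans cost_gt0 (mu_le th N Xx).
by rewrite dotvZr dotv_delta mxE pmulr_rgt0.
Qed.

Lemma iter_policy_map_cvg i j :
  iter N (T mu) 0 i j @[N --> \oo] --> c i j.
Proof.
apply: (squeeze_cvgr (h := fun=> c i j) _ (@vi_c i j) (@cvg_cst _ _ _ _ _)).
near=> N; rewrite iter_policy_map_le// andbT.
exact: vi_le_iter_policy_map.
Unshelve. all: by end_near. Qed.

(* If c' <= K c with K >= 0, affinity of T gives T^N c' <= K c + (1 - K) T^N 0,
   whose limit is c. *)
Lemma le_fixpoint c' : observability P -> Cset c' -> c' = Gbar P c' ->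
  forall i j, c' i j <= c i j.
Proof.
move=> obs c'0 c'G.
have c_gt0 := fixpoint_gt0 obs.
have [K K0 c'K] : exists2 K, 0 <= K & forall i j, c' i j <= K * c i j.
  (* The sum of all the ratios, being a sum of nonnegative terms, dominates each of them. *)
  exists (\sum_i \sum_j c' i j / c i j).
    apply: sumr_ge0 => i _; apply: sumr_ge0 => j _.
    by rewrite divr_ge0//; exact: c'0.
  move=> i j; rewrite -ler_pdivrMr//.
  rewrite (bigD1 i)//= (bigD1 j)//= -addrA lerDl addr_ge0//.
    by apply: sumr_ge0 => k _; rewrite divr_ge0//; exact: c'0.
  apply: sumr_ge0 => k _; apply: sumr_ge0 => l _.
  by rewrite divr_ge0//; exact: c'0.
(* For [N = 0] this is the choice of [K]. Then [c' = Gbar P c'] lies below [T mu c'], and [T mu],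
   monotone and affine with fixed point [c], carries the bound from [N] to [N.+1] whatever the sign
   of [1 - K]. *)
have c'_le N i j : c' i j <= K * c i j + (1 - K) * iter N (T mu) 0 i j.
  elim: N i j => [|N IHN] i j; first by rewrite mxE mulr0 addr0.
  rewrite {1}c'G.
  apply: le_trans (Gbar_le_policy_map hsl hclosure hstate mu_Mhat c'0 i j) _.
  have -> : K * c i j + (1 - K) * iter N.+1 (T mu) 0 i j =
      T mu (K *: c + (1 - K) *: iter N (T mu) 0) i j.
    by rewrite policy_map_affine -mu_c !mxE.
  by apply: le_policy_map => // i' j'; rewrite !mxE.
move=> i j.
have lim_le : K * c i j + (1 - K) * iter N (T mu) 0 i j @[N --> \oo] -->
    K * c i j + (1 - K) * c i j.
  apply: cvgD; first exact: cvg_cst.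
  by apply: cvgM; [exact: cvg_cst|exact: iter_policy_map_cvg].
have -> : c i j = K * c i j + (1 - K) * c i j by ring.
rewrite -(cvg_lim _ lim_le)//; apply: limr_ge.
  by apply/cvg_ex; eexists; exact: lim_le.
by near=> N; exact: c'_le.
Unshelve. all: by end_near. Qed.

End FixedPoint.
End Costs.

Theorem proposition10 (R : realType) (n r : nat) (C : Type)
    (P : mjproblem R n r C)
    (n_gt0 : (0 < n)%N) (r_gt0 : (0 < r)%N)
    (hsl : mj_semilinear P)
    (hdet : deterministic_wf P)
    (hclosure : closure_attainability P)
    (hstab : stabilizability P)
    (hstate : state_space_structure P)
    (hobs : observability P)
    (hcart : cartesian_product P) :
  (exists c : 'M[R]_(n, r),
     [/\ Cset c,
         forall x th, mj_X P x -> Jstar P x th = (dotv (col th c) x)%:E,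
         forall xb, Xbar P xb ->
           Jbarstar P xb = (\sum_(th < r) dotv (col th c) (xb th))%:E,
         c = Gbar P c
       & forall c' : 'M[R]_(n, r), Cset c' -> c' = Gbar P c' -> c' = c])
  /\
  ((forall mu, mj_Mhat P mu ->
      (mj_optimal P mu <-> det_optimal P (lift_policy mu)))
   /\ (exists mu, is_policy P mu /\ mj_optimal P mu)).
Proof.
have [c [c0 cG vi_c]] := vi_cvg hsl hclosure hstate hstab.
(* The policy attaining [Gbar P c] has [c] as fixed point of its own affine map; it is the optimal
   policy. *)
have [mu Mmu GT] := Gbar_attained hsl hclosure hstate hcart c0.
have cT : c = policy_map P mu c by rewrite -GT.
split; [exists c; split=> //|split].
- by move=> x th Xx; exact: (JstarE hsl hclosure c0 vi_c Mmu cT).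
- by move=> xb Xxb; exact: (JbarstarE hsl hdet hclosure c0 vi_c Mmu cT).
- move=> c' c'0 c'G; apply/matrixP => i j; apply/eqP; rewrite eq_le.
  rewrite (le_fixpoint hsl hclosure hstate c0 vi_c Mmu cT)//=.
  (* The value iterates lie below the fixed point [c'], hence so does their limit [c]. *)
  rewrite -(cvg_lim _ (vi_c i j))//; apply: limr_le.
    by apply/cvg_ex; exists (c i j).
  by near=> N; exact: vi_le_fixpoint.
- move=> nu Mnu.
  exact: (mj_optimal_iff_det_optimal hsl hdet hclosure hstate c0 vi_c Mmu cT).
- exists mu; split; first exact: (sl_Mhat_policy hsl).
  exact: (mj_optimal_fixpoint hsl hclosure c0 vi_c Mmu cT).
Unshelve. all: by end_near. Qed.
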